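(* Let $m\ge5$ and $l\ge2$ be integers and let $G=C_{lm}(S)$ with $S=\{s\in\{1,\dots,\lfloor lm/2\rfloor\}: s=l\text{ or } l\nmid s\}$ (equivalently, the join of $l$ copies of the cycle $C_m$). Then for $i\ge1$, $$\beta_{i,i+1}(G)=lm\binom{(l-1)m+1}{i-1}+(l-1)\binom{lm}{i+1}-l\binom{(l-1)m}{i+1}.$$
   Context: The circulant graph $C_n(S)$ ($S\subseteq\{1,\dots,\lfloor n/2\rfloor\}$) has vertex set $\{0,\dots,n-1\}$ with $\{a,b\}$ an edge iff $\min(|a-b|,n-|a-b|)\in S$. For a graph $G$ on vertex set $V$, $R=\mathbb{K}[x_v:v\in V]$ over a fixed field $\mathbb{K}$, $I(G)=\langle x_ux_v:\{u,v\}\in E(G)\rangle$, and $\beta_{i,d}(G)=\beta_{i,d}(R/I(G))$ is the graded Betti number. Binomial coefficients $\binom{a}{b}$ are $0$ if $b<0$ or $b>a$. *)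

(* Defs.v *)
From HB Require Import structures.
From mathcomp Require Import all_boot all_order all_algebra.
Set Implicit Arguments. Unset Strict Implicit. Unset Printing Implicit Defensive.
Import GRing.Theory.
Local Open Scope ring_scope.

Definition circ_adj (n : nat) (S : pred nat) : rel 'I_n :=
  fun a b =>
    let d := if (a <= b)%N then (b - a)%N else (a - b)%N in
    (a != b) && S (minn d (n - d)).

Definition join_cycles_S (l m : nat) : pred nat :=
  fun s => [&& (1 <= s)%N, (s <= (l * m)./2)%N & (s == l) || ~~ (l %| s)%N].

(* R = K[x_v : v in 'I_n], I(G) generated by x_u x_v for edges {u,v}.
   beta_{i,d}(R/I) = dim_K Tor_i^R(R/I, K)_d, computed by the Koszul complex
   K(x_1..x_n) (x) R/I, which splits into finite-dimensional pieces by
   multidegree a in N^n.  In multidegree a, the i-th chain space has K-basis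
   e_F (x) x^(a - 1_F) for F subset of vertices with |F| = i, F in supp(a) and
   x^(a - 1_F) not in I(G). *)

Section Koszul.
Variable (K : fieldType) (n : nat) (adj : rel 'I_n).

Definition in_edge_ideal (b : 'I_n -> nat) : bool :=
  [exists u, exists v, [&& adj u v, (0 < b u)%N & (0 < b v)%N]].

Definition kvalid (a : 'I_n -> nat) (F : {set 'I_n}) : bool :=
  [forall v, (v \in F) ==> (0 < a v)%N] &&
  ~~ in_edge_ideal (fun v => (a v - (v \in F))%N).

Definition kdiff (a : 'I_n -> nat) (i : nat) (F F' : {set 'I_n}) : K :=
  if [&& #|F| == i, kvalid a F, kvalid a F', F' \subset F & #|F| == #|F'|.+1]
  then match [pick j in F :\: F'] with
       | Some j => (-1) ^+ #|[set k in F | (k < j)%N]|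
       | None => 0
       end
  else 0.

Definition kmx (a : 'I_n -> nat) (i : nat) : 'M[K]_#|{: {set 'I_n}}| :=
  \matrix_(p, q) kdiff a i (enum_val p) (enum_val q).

Definition betti_md (a : 'I_n -> nat) (i : nat) : nat :=
  (#|[set F : {set 'I_n} | (#|F| == i) && kvalid a F]|
    - \rank (kmx a i) - \rank (kmx a i.+1))%N.

Definition betti (i d : nat) : nat :=
  (\sum_(a : {ffun 'I_n -> 'I_d.+1} | (\sum_v (a v : nat))%N == d)
     betti_md (fun v => (a v : nat)) i)%N.

End Koszul.

(* Main.v *)
Require Import Defs.
From mathcomp Require Import all_boot all_order all_algebra.
From mathcomp Require Import zify ring.
Set Implicit Arguments. Unset Strict Implicit. Unset Printing Implicit Defensive.
Import GRing.Theory.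
Local Open Scope ring_scope.

(* In the linear strand only squarefree multidegrees contribute.  For W with
   |W| = i + 1 the i-chains are indexed by the vertices of W and the differential
   out of them is, up to signs, the coboundary map of the complement of G[W];
   hence W contributes one less than the number of connected components of that
   complement.  For a join of cycles C_m with m >= 5 the components can be counted
   cycle by cycle: the complement of the subgraph of C_m induced on a nonempty set
   A is connected, except that it has two components when A spans an edge or a
   path on three vertices.  Summing over W gives the formula. *)

(** * Rank computed from a set of pivot rows *)

(* Rank-nullity without a basis: if vanishing off R is complementary to the
   left kernel, the rank is #|R|. *)
Lemma mxrank_pivots (K : fieldType) (T T' : finType) (f : T -> T' -> K)
    (R : {set T}) :
    (forall u : T -> K, (forall t', \sum_t u t * f t t' = 0) ->
       (forall t, t \notin R -> u t = 0) -> forall t, t \in R -> u t = 0) ->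
    (forall s, s \notin R -> exists u : T -> K,
       (forall t', \sum_t u t * f t t' = 0) /\
       (forall t, t \notin R -> u t = (t == s)%:R)) ->
  \rank (\matrix_(p < #|T|, q < #|T'|) f (enum_val p) (enum_val q)) = #|R|.
Proof.
move=> ker_inj ker_surj; set A := (\matrix_(p, q) _).
(* Multiplication by [E] reads off the coordinates outside [R]. *)
pose E : 'M[K]_(#|T|, #|~: R|) := \matrix_(p, j) (enum_val p == enum_val j)%:R.
have mulA (u : T -> K) : (\row_p u (enum_val p)) *m A = 0 <->
    forall t', \sum_t u t * f t t' = 0.
  split=> [uA t' | uA].
    move/rowP/(_ (enum_rank t')): uA; rewrite !mxE => uAt; rewrite -[RHS]uAt.
    rewrite [LHS](reindex_onto enum_val enum_rank) => [|t _]; last exact: enum_rankK.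
    apply: eq_big => [p|p _]; first by rewrite enum_valK eqxx.
    by rewrite !mxE enum_rankK.
  apply/rowP=> q; rewrite !mxE -[RHS](uA (enum_val q)).
  rewrite [RHS](reindex_onto enum_val enum_rank) => [|t _]; last exact: enum_rankK.
  apply: eq_big => [p|p _]; first by rewrite enum_valK eqxx.
  by rewrite !mxE.
have mulE (u : T -> K) j : ((\row_p u (enum_val p)) *m E) 0 j = u (enum_val j).
  rewrite mxE (bigD1 (enum_rank (enum_val j))) //= big1 => [|p p_j].
    by rewrite !mxE enum_rankK eqxx mulr1 addr0.
  by rewrite !mxE -(inj_eq enum_rank_inj) enum_valK (negPf p_j) mulr0.
(* By [ker_inj], a row vector killed by both [A] and [E] is zero, so [row_mx A E] has rank [#|T|],
   while [E] contributes at most its number of columns. *)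
have lb : (#|T| <= \rank A + #|~: R|)%N.
  have freeAE : row_free (row_mx A E).
    apply: inj_row_free => v; rewrite mul_mx_row -[0]row_mx0.
    case/eq_row_mx; pose u t := v 0 (enum_rank t).
    have -> : v = \row_p u (enum_val p).
      by apply/rowP=> p; rewrite mxE /u enum_valK.
    move=> /mulA uA uE.
    have u0 t : t \notin R -> u t = 0.
      rewrite -in_setC => tR; have := mulE u (enum_rank_in tR t).
      by rewrite uE mxE enum_rankK_in.
    apply/rowP=> p; rewrite !mxE.
    by case: (boolP (enum_val p \in R)) => [/(ker_inj u uA u0)|/u0].
  rewrite -{1}(eqP freeAE) -mxrank_tr tr_row_mx -addsmxE.
  apply: leq_trans (mxrank_adds_leqif _ _) _.
  by rewrite !mxrank_tr leq_add2l rank_leq_col.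
(* [ker_surj] gives one kernel vector per index outside [R], dual to the coordinates read by [E];
   these are the rows of [P], so [P] is row-free and [P *m A = 0]. *)
have ub : (#|~: R| + \rank A <= #|T|)%N.
  have ex (j : 'I_#|~: R|) : exists u : {ffun T -> K}, (forall t', \sum_t u t * f t t' = 0) /\
      forall t, t \notin R -> u t = (t == enum_val j)%:R.
    have := enum_valP j; rewrite inE => /ker_surj[u [uA uE]].
    exists [ffun t => u t]; split=> [t'|t /uE]; last by rewrite ffunE.
    by rewrite -[RHS](uA t'); apply: eq_bigr => t _; rewrite ffunE.
  have [w wP] := fin_all_exists ex.
  pose P := \matrix_(j < #|~: R|, p < #|T|) w j (enum_val p).
  have rowPE j : row j P = \row_p w j (enum_val p).
    by apply/rowP=> p; rewrite !mxE.
  have PE : P *m E = 1%:M.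
    apply/matrixP=> j k.
    have -> : (P *m E) j k = (row j P *m E) 0 k by rewrite -row_mul !mxE.
    rewrite rowPE mulE (proj2 (wP j)).
      by rewrite mxE (inj_eq enum_val_inj) eq_sym.
    by rewrite -in_setC enum_valP.
  have rankP : \rank P = #|~: R|.
    by apply/eqP; rewrite -/(row_free P); apply/row_freeP; exists E.
  rewrite -rankP; apply: mulmx0_rank_max; apply/row_matrixP=> j.
  by rewrite row_mul row0 rowPE; apply/mulA; case: (wP j).
by have := cardsC R; move: lb ub; lia.
Qed.

Lemma setD1_inj (T : finType) (W : {set T}) : {in W &, injective (fun v => W :\ v)}.
Proof.
move=> v w vW wW /setP/(_ v); rewrite !inE eqxx vW andbT /=.
by case: eqP.
Qed.

Lemma setD1_eq (T : finType) (W : {set T}) v w :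
  v \in W -> w \in W -> (W :\ v == W :\ w) = (v == w).
Proof. by move=> vW wW; apply/eqP/eqP => [/setD1_inj->|->]. Qed.

Lemma subset_cardS (T : finType) (F W : {set T}) :
  F \subset W -> #|W| = #|F|.+1 -> exists2 v, v \in W & F = W :\ v.
Proof.
move=> FW cW; have /cards1P[v Wv] : #|W :\: F| == 1%N.
  by rewrite cardsD (setIidPr FW) cW subSnn.
have : v \in W :\: F by rewrite Wv set11.
rewrite inE => /andP[vF vW]; exists v => //.
by rewrite -Wv setDDr setDv set0U (setIidPr FW).
Qed.

(** * Multigraded Koszul homology in the linear strand *)

Section LinearStrand.
Variables (K : fieldType) (n : nat) (adj : rel 'I_n).
Hypotheses (adj_irr : irreflexive adj) (adj_sym : symmetric adj).

(** Each vertex of [W] also carries a loop, as [adj] is irreflexive; loops do not affect the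
    components. *)
Definition coadj (W : {set 'I_n}) : rel 'I_n :=
  [rel u v | [&& u \in W, v \in W & ~~ adj u v]].

(* One representative for each component of the complement of G[W]. *)
Definition coroots (W : {set 'I_n}) : {set 'I_n} :=
  [set v in W | fingraph.root (coadj W) v == v].

Lemma coadj_sym W : connect_sym (coadj W).
Proof. by apply: sym_connect_sym => u v; rewrite /coadj /= adj_sym andbCA. Qed.

Lemma coadj_connect_in W u v : connect (coadj W) u v -> (u \in W) = (v \in W).
Proof.
apply: (closed_connect (a := mem W)) => x y.
by case/and3P=> xW yW _; rewrite xW yW.
Qed.

Lemma coroot_in W v : (fingraph.root (coadj W) v \in W) = (v \in W).
Proof. by rewrite -(coadj_connect_in (connect_root _ _)). Qed.

Section Squarefree.
Variables (W : {set 'I_n}) (a : 'I_n -> nat).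
Hypothesis aW : forall v, a v = (v \in W) :> nat.

(** For squarefree [a] the monomial [x^(a - 1_F)] is the product of the variables in [W :\: F],
    which avoids the edge ideal exactly when that set is independent. *)
Lemma kvalidP (F : {set 'I_n}) :
  reflect (F \subset W /\ {in W :\: F &, forall u v, ~~ adj u v}) (kvalid adj a F).
Proof.
have F_a (v : 'I_n) : (v \in F -> v \in W) -> (0 < a v - (v \in F))%N = (v \in W :\: F).
  by rewrite aW inE; case: (v \in W); case: (v \in F) => // /(_ isT).
apply: (iffP andP) => [[/forall_inP FW /existsPn noE] | [FW noE]].
  have {}FW : F \subset W by apply/subsetP=> v /FW; rewrite aW lt0b.
  split=> // u v uF vF; apply: contra (noE u) => uv; apply/existsP; exists v.
  by rewrite uv !F_a ?uF ?vF //; apply: (subsetP FW).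
split; first by apply/forall_inP=> v /(subsetP FW) vW; rewrite aW vW.
apply/existsPn=> u; apply/existsPn=> v.
rewrite !F_a; try exact: (subsetP FW).
by apply/and3P=> -[uv uF vF]; move: (noE _ _ uF vF); rewrite uv.
Qed.

Variable i : nat.
Hypothesis cardW : #|W| = i.+1.

Lemma kvalid_setD1 v : kvalid adj a (W :\ v).
Proof.
apply/kvalidP; split=> [|x y]; first exact: subD1set.
rewrite !inE negb_and !negbK.
case: eqP => [->|_ /andP[/negP]//] _.
by case: eqP => [->|_ /andP[/negP]//]; rewrite adj_irr.
Qed.

Lemma kvalid_card (F : {set 'I_n}) :
  #|F| == i -> kvalid adj a F -> exists2 v, v \in W & F = W :\ v.
Proof. by move=> /eqP Fi /kvalidP[FW _]; apply: subset_cardS; rewrite ?Fi. Qed.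

Lemma card_kvalid : #|[set F : {set 'I_n} | (#|F| == i) && kvalid adj a F]| = i.+1.
Proof.
rewrite -cardW -(card_in_imset (@setD1_inj _ W)); apply: eq_card => F; rewrite !inE.
apply/andP/imsetP => [[] | [v vW ->]]; first exact: kvalid_card.
by rewrite kvalid_setD1; split=> //; have := cardsD1 v W; rewrite vW cardW => -[->].
Qed.

(** The Koszul sign of deleting [v] from the whole of [W]. Rescaling the coefficient of [W :\ v] by
    it removes the vertex order from the kernel condition. *)
Definition ksign (v : 'I_n) : K := (-1) ^+ #|[set k in W | (k < v)%N]|.

Lemma ksign_neq0 v : ksign v != 0.
Proof. by rewrite signr_eq0. Qed.

Lemma ksignK v : ksign v * ksign v = 1.
Proof. by rewrite -expr2 sqrr_sign. Qed.

(** Deleting [v] first lowers the number of elements below [w] by one exactly when [v < w], hence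
    the correction to [ksign w]. *)
Lemma kdiffE v w : v \in W -> w \in W -> v != w -> ~~ adj v w ->
  kdiff K adj a i (W :\ v) (W :\ v :\ w) = ksign w * (-1) ^+ (v < w)%N.
Proof.
move=> vW wW vw nvw; rewrite /kdiff.
have wWv : w \in W :\ v by rewrite !inE eq_sym vw.
have cWv : #|W :\ v| = i by have := cardsD1 v W; rewrite vW cardW => -[->].
have cWvw := cardsD1 w (W :\ v); rewrite wWv /= in cWvw.
have -> : kvalid adj a (W :\ v :\ w).
  apply/kvalidP; split=> [|x y].
    by apply: subset_trans (subD1set _ _) (subD1set _ _).
  rewrite !inE; case: (eqVneq x w) => [->|_] /=; last first.
    case: (eqVneq x v) => [->|_] /= ; last by case: (x \in W).
    move=> _; case: (eqVneq y w) => [->|_] //=.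
    by case: (eqVneq y v) => [->|_] /=; [rewrite adj_irr | case: (y \in W)].
  move=> _; case: (eqVneq y w) => [->|_] /=; first by rewrite adj_irr.
  by case: (eqVneq y v) => [->|_] /=; [rewrite adj_sym | case: (y \in W)].
rewrite cWv eqxx kvalid_setD1 subD1set /= -cWv cWvw eqxx.
have -> : (W :\ v) :\: (W :\ v :\ w) = [set w].
  apply/setP=> x; rewrite !inE; case: (eqVneq x w) => [->|_] //=.
    by rewrite eq_sym vw wW.
  by case: (x \in W); rewrite ?andbF ?andbT //; case: (x == v).
case: pickP => [j /set1P-> | /(_ w)]; last by rewrite set11.
rewrite /ksign (cardsD1 v [set k in W | (k < w)%N]) inE vW /= addnC exprD -mulrA -expr2.
rewrite sqrr_sign mulr1; congr (_ ^+ _); apply: eq_card => k.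
by rewrite !inE andbA.
Qed.

(** The two deleted vertices are all of [W :\: F'], so validity of [F'] is what makes them
    nonadjacent. *)
Lemma kdiff_neq0 (F F' : {set 'I_n}) : kdiff K adj a i F F' != 0 ->
  exists v w, [/\ v \in W, w \in W, v != w, ~~ adj v w &
    F = W :\ v /\ F' = W :\ v :\ w].
Proof.
rewrite /kdiff; case: ifP => [/and5P[Fi Fval F'val F'F /eqP cF] _|]; last by rewrite eqxx.
have [v vW FE] := kvalid_card Fi Fval.
have [w wF F'E] := subset_cardS F'F cF.
rewrite FE in wF F'E; have := wF; rewrite !inE => /andP[wv wW].
exists v, w; split; rewrite // 1?eq_sym //.
have /kvalidP[_ -> //] := F'val; rewrite F'E !inE eqxx ?vW ?wW ?andbF ?andbT //.
Qed.

(* Only the rows W :\ v and W :\ w meet the column W :\ v :\ w, and the signs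
   [ksign] turn the two entries into opposite ones. *)
Lemma kdiff_comb (u : {set 'I_n} -> K) v w :
    v \in W -> w \in W -> v != w -> ~~ adj v w ->
  \sum_F u F * kdiff K adj a i F (W :\ v :\ w) =
  (-1) ^+ (v < w)%N * ksign v * ksign w *
    (ksign v * u (W :\ v) - ksign w * u (W :\ w)).
Proof.
move=> vW wW vw nvw.
rewrite (bigD1 (W :\ v)) //= (bigD1 (W :\ w)) /=; last by rewrite setD1_eq // eq_sym.
rewrite big1 => [|F /andP[Fv Fw]]; last first.
  apply/eqP; rewrite mulf_eq0; apply/orP; right; apply: contraT => /kdiff_neq0.
  case=> x [y [xW yW xy _ [FE]]] /setP E; move: Fv Fw.
  rewrite FE !setD1_eq // => xv xw; have := E x; rewrite !inE eqxx xW /=.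
  by rewrite xv xw andbF.
rewrite kdiffE // setDDl setUC -setDDl kdiffE // 1?eq_sym 1?adj_sym //.
(* Exactly one of the two orders holds, whence the opposite signs. *)
have -> : (w < v)%N = ~~ (v < w)%N by move: vw; rewrite -(inj_eq val_inj) /=; case: ltngtP.
have eK := ksignK; move: (eK v) (eK w).
move: (ksign v) (ksign w) (u _) (u _) => sv sw uv uw Ev Ew.
rewrite mulrBr addr0; congr (_ + _); first by rewrite -[LHS]mul1r -{1}Ev; ring.
by rewrite -[LHS]mul1r -{1}Ew; case: (v < w)%N; rewrite /= ?expr0 ?expr1; ring.
Qed.

(** After rescaling by [ksign], the kernel condition is constancy along the edges of the complement,
    hence on its components; sets not of the form [W :\ v] are unconstrained. *)
Lemma kdiff_kerP (u : {set 'I_n} -> K) :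
  (forall F', \sum_F u F * kdiff K adj a i F F' = 0) <->
  {in W &, forall v w, ~~ adj v w -> ksign v * u (W :\ v) = ksign w * u (W :\ w)}.
Proof.
split=> [ker v w vW wW nvw | eq_u F'].
  case: (eqVneq v w) => [-> //|vw].
  have /eqP := ker (W :\ v :\ w); rewrite kdiff_comb // !mulf_eq0.
  by rewrite signr_eq0 !(negPf (ksign_neq0 _)) /= subr_eq0 => /eqP.
have [/existsP[F /kdiff_neq0] | /existsPn all0] :=
  boolP [exists F, kdiff K adj a i F F' != 0]; last first.
  by apply: big1 => F _; rewrite (eqP (negbNE (all0 F))) mulr0.
case=> v [w [vW wW vw nvw [_ ->]]].
by rewrite kdiff_comb // (eq_u v w) // subrr mulr0.
Qed.

(** The pivots are the sets [W :\ v] with [v] not a root: a kernel vector is determined on a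
    component by its value at the root, and that value can be prescribed freely. *)
Lemma mxrank_kmx : \rank (kmx K adj a i) = (#|W| - #|coroots W|)%N.
Proof.
pose R := [set W :\ v | v in W :\: coroots W].
have RE v : v \in W -> (W :\ v \in R) = (fingraph.root (coadj W) v != v).
  move=> vW; apply/imsetP/idP => [[w] | rv].
    by rewrite !inE => /andP[rw wW] /setD1_inj -> //; move: rw; rewrite wW.
  by exists v; rewrite // !inE vW /= rv.
have rootE v w : v \in W -> w \in W -> ~~ adj v w ->
    fingraph.root (coadj W) v = fingraph.root (coadj W) w.
  move=> vW wW nvw; apply/(fingraph.rootP (@coadj_sym W)); apply: connect1.
  by rewrite /coadj /= vW wW.
have cR : #|R| = (#|W| - #|coroots W|)%N.
  rewrite card_in_imset => [|v w]; last first.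
    by rewrite !inE => /andP[_ vW] /andP[_ wW]; apply: setD1_inj.
  by rewrite cardsD (setIidPr _) //; apply/subsetP=> v; rewrite inE => /andP[].
rewrite -cR; apply: mxrank_pivots => [u /kdiff_kerP eq_u u0 F | s sR].
  case/imsetP=> v; rewrite !inE => /andP[_ vW] ->.
  set r := fingraph.root (coadj W) v.
  have rW : r \in W by rewrite coroot_in.
  have : ksign r * u (W :\ r) = 0.
    by rewrite u0 ?mulr0 // RE // negbK /r root_root //; apply: coadj_sym.
  have -> : ksign r * u (W :\ r) = ksign v * u (W :\ v).
    (* [B] is closed under complement edges and contains [v], so it contains the root of [v]. *)
    pose B := [set x in W | ksign x * u (W :\ x) == ksign v * u (W :\ v)].
    suff: r \in B by rewrite inE => /andP[_ /eqP].
    rewrite -(closed_connect (a := mem B) _ (connect_root (coadj W) v)).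
      by rewrite inE vW eqxx.
    by move=> x y /and3P[xW yW nxy]; rewrite !inE xW yW (eq_u x y).
  by move/eqP; rewrite mulf_eq0 (negPf (ksign_neq0 _)) => /eqP.
have [/existsP[x /andP[xW /eqP sE]] | /existsPn noW] :=
  boolP [exists x, (x \in W) && (s == W :\ x)].
  have rx : fingraph.root (coadj W) x = x by apply/eqP; rewrite -[_ == _]negbK -RE // -sE.
  (* The signed indicator of the component of [x]; the factor [ksign x] normalises its value at
     [W :\ x] to 1. *)
  pose u F := \sum_(v in W | fingraph.root (coadj W) v == x)
    ksign v * ksign x * (F == W :\ v)%:R.
  have uE v : v \in W -> u (W :\ v) =
      (fingraph.root (coadj W) v == x)%:R * (ksign v * ksign x).
    move=> vW; case: (boolP (_ == x)) => rv; last first.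
      rewrite mul0r /u big1 // => w /andP[wW rw]; rewrite setD1_eq //.
      by case: eqP => [vw|]; [rewrite vw rw in rv | rewrite mulr0].
    rewrite /u (bigD1 v) /=; last by rewrite vW.
    rewrite eqxx mulr1 mul1r big1 ?addr0 // => w /andP[/andP[wW _] wv].
    by rewrite setD1_eq // eq_sym (negPf wv) mulr0.
  exists u; split=> [|t tR].
    apply/kdiff_kerP=> v w vW wW nvw; rewrite !uE // (rootE v w) //.
    by rewrite mulrCA [RHS]mulrCA (mulrA (ksign v)) (mulrA (ksign w)) !ksignK.
  have [/existsP[v /andP[vW /eqP tE]] | /existsPn noW] :=
    boolP [exists v, (v \in W) && (t == W :\ v)].
    have rv : fingraph.root (coadj W) v = v by apply/eqP; rewrite -[_ == _]negbK -RE // -tE.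
    rewrite tE uE // sE setD1_eq // rv; case: eqP => [->|]; last by rewrite mul0r.
    by rewrite ksignK mulr1.
  rewrite /u big1 => [|v /andP[vW _]].
    by case: eqP => // ts; have := noW x; rewrite xW ts sE eqxx.
  by have := noW v; rewrite vW /= => /negPf->; rewrite mulr0.
(* Here [s] is no [W :\ v], so its row is zero and the indicator of [s] lies in the kernel. *)
exists (fun F => (F == s)%:R); split=> //.
have nW v : v \in W -> (W :\ v == s) = false.
  by move=> vW; have := noW v; rewrite vW /= eq_sym => /negPf.
by apply/kdiff_kerP=> v w vW wW _; rewrite !nW // !mulr0.
Qed.

(** [W] itself is the only valid set of size [i.+1], so just one row can be nonzero, and it is. *)
Lemma mxrank_kmxS : \rank (kmx K adj a i.+1) = 1%N.
Proof.
have F_W F F' : kdiff K adj a i.+1 F F' != 0 -> F = W.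
  rewrite /kdiff; case: ifP => [/and5P[/eqP Fi /kvalidP[FW _] _ _ _] _|]; last by rewrite eqxx.
  by apply/eqP; rewrite eqEcard FW Fi cardW leqnn.
have [v vW] : exists v, v \in W by apply/set0Pn; rewrite -card_gt0 cardW.
have Wv : kdiff K adj a i.+1 W (W :\ v) != 0.
  have cWv : #|W :\ v| = i by have := cardsD1 v W; rewrite vW cardW => -[->].
  rewrite /kdiff cardW cWv !eqxx kvalid_setD1 subD1set.
  have -> : kvalid adj a W.
    by apply/kvalidP; split=> // x y; rewrite setDv inE.
  case: pickP => [j _ | /(_ v)] /=; first by rewrite signr_eq0.
  by rewrite !inE eqxx vW.
rewrite -(cards1 W); apply: mxrank_pivots => [u ker u0 F | s].
  rewrite inE => /eqP->; have /eqP := ker (W :\ v).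
  rewrite (bigD1 W) //= big1 => [|F' F'W].
    by rewrite addr0 mulf_eq0 (negPf Wv) orbF => /eqP.
  by rewrite u0 ?mul0r // inE.
rewrite inE => sW; exists (fun t => (t == s)%:R); split=> // F'.
apply: big1 => F _; case: (eqVneq (kdiff K adj a i.+1 F F') 0) => [->|/F_W->].
  by rewrite mulr0.
by rewrite eq_sym (negPf sW) mul0r.
Qed.

Lemma betti_md_sqfree : betti_md K adj a i = (#|coroots W| - 1)%N.
Proof.
rewrite /betti_md card_kvalid mxrank_kmx mxrank_kmxS cardW.
have : (#|coroots W| <= #|W|)%N; last by lia.
by apply/subset_leq_card/subsetP=> v; rewrite inE => /andP[].
Qed.

End Squarefree.

(** At most one chain lives in this multidegree, and its differential is nonzero, so no homology is
    left. *)
Lemma betti_md_nonsqfree (a : 'I_n -> nat) (i : nat) (v : 'I_n) :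
  (0 < i)%N -> (\sum_v a v = i.+1)%N -> (1 < a v)%N -> betti_md K adj a i = 0%N.
Proof.
move=> i0 sum_a av.
pose S := [set F : {set 'I_n} | (#|F| == i) && kvalid adj a F].
(* The monomial [x^(a - 1_F)] has degree 1 and is divisible by [x_v] because [a v] is at least 2; so
   it is [x_v], and [F] is determined by [a]. *)
have aE F : F \in S -> forall w, a w = ((w \in F) + (w == v))%N.
  rewrite inE => /andP[/eqP Fi /andP[/forall_inP F_a _]].
  have F_le w : ((w \in F) <= a w)%N by case: (boolP (w \in F)) => // /F_a.
  have : (\sum_w (a w - (w \in F)) = 1)%N.
    have sumF : (\sum_w (w \in F) = i)%N.
      rewrite -Fi -sum1_card [RHS]big_mkcond.
      by apply: eq_bigr => w _; case: (w \in F).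
    by rewrite sumnB // sum_a sumF subSnn.
  rewrite (bigD1 v) //=; set rest := (X in (_ + X)%N) => sum1.
  have rest0 : rest = 0%N by move: sum1; case: (v \in F); lia.
  move=> w; have := F_le w; case: (eqVneq w v) => [->|wv].
    by move: sum1; rewrite rest0; case: (v \in F); lia.
  by move/eqP: rest0; rewrite sum_nat_eq0 => /forall_inP/(_ w wv); lia.
rewrite /betti_md -/S; have [->|[F FS]] := set_0Vmem S; first by rewrite cards0 !sub0n.
have cS : (#|S| <= 1)%N.
  rewrite -(cards1 F); apply: subset_leq_card; apply/subsetP=> F' F'S.
  rewrite inE; apply/eqP/setP=> w.
  by have := aE _ F'S w; rewrite (aE _ FS w); case: (w \in F); case: (w \in F'); lia.
have vF : v \in F by have := aE _ FS v; rewrite eqxx; case: (v \in F); lia.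
have := FS; rewrite inE => /andP[/eqP Fi Fval].
(* The monomial left by [F :\ v] is the square of [x_v], which is not in the edge ideal since [adj]
   has no loops. *)
have : kdiff K adj a i F (F :\ v) != 0.
  have cF := cardsD1 v F; rewrite vF add1n in cF.
  have -> : kdiff K adj a i F (F :\ v) =
      if [pick j in F :\: (F :\ v)] is Some j
      then (-1) ^+ #|[set k in F | (k < j)%N]| else 0.
    rewrite /kdiff Fi eqxx Fval subD1set -Fi cF eqxx !andbT /=.
    suff -> : kvalid adj a (F :\ v) by [].
    apply/andP; split.
      by apply/forall_inP=> w; rewrite !inE (aE _ FS) => /andP[_ ->].
    apply/existsPn=> x; apply/existsPn=> y; rewrite !(aE _ FS) !inE.
    have [->|_] := eqVneq x v; have [->|_] := eqVneq y v; rewrite ?adj_irr //=.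
      by rewrite addn0 subnn ltnn !andbF.
    by rewrite addn0 subnn ltnn !andbF.
    by rewrite !addn0 !subnn ltnn !andbF.
  case: pickP => [j _ | /(_ v)] /=; first by rewrite signr_eq0.
  by rewrite !inE eqxx vF.
move=> kd; have : kmx K adj a i != 0.
  apply: contraNneq kd => /matrixP/(_ (enum_rank F) (enum_rank (F :\ v))).
  by rewrite !mxE !enum_rankK => ->.
by rewrite -mxrank_eq0; move: cS; lia.
Qed.

Lemma betti_linear_strand (i : nat) : (0 < i)%N ->
  betti K adj i i.+1 = (\sum_(W : {set 'I_n} | #|W| == i.+1) (#|coroots W| - 1))%N.
Proof.
move=> i0; rewrite /betti (bigID (fun a : {ffun 'I_n -> 'I_i.+2} => [forall v, (a v <= 1)%N])) /=.
rewrite [X in (_ + X)%N]big1 ?addn0 => [|a /andP[/eqP sum_a /forallPn[v]]]; last first.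
  by rewrite -ltnNge => av; apply: (betti_md_nonsqfree (v := v)).
(* Squarefree multidegrees correspond to vertex sets by indicator and support. *)
pose ind (W : {set 'I_n}) : {ffun 'I_n -> 'I_i.+2} := [ffun v => inord (v \in W)].
have indE W v : ind W v = (v \in W) :> nat by rewrite ffunE inordK //; case: (v \in W).
rewrite (reindex_onto ind (fun a => [set v | (0 < a v)%N])) /= => [|a /andP[_ /forallP a1]].
  apply: eq_big => [W|W /andP[/andP[/eqP sumW _] _]].
    have -> : [set v | (0 < ind W v)%N] = W by apply/setP=> v; rewrite inE indE lt0b.
    rewrite eqxx andbT (eq_bigr (fun v => if v \in W then 1%N else 0%N)).
      rewrite -big_mkcond sum1_card andbC; suff -> : [forall v, (ind W v <= 1)%N] by [].
      by apply/forallP=> v; rewrite indE leq_b1.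
    by move=> v _; rewrite indE; case: (v \in W).
  apply: betti_md_sqfree => [v|]; first exact: indE.
  rewrite -sumW -sum1_card big_mkcond; apply: eq_bigr => v _.
  by rewrite indE; case: (v \in W).
apply/ffunP=> v; apply: val_inj; rewrite /= indE inE.
by have := a1 v; case: (a v : nat) => [|[]].
Qed.
End LinearStrand.

(** Such a [W] is [B] together with an arbitrary subset of the complement of [C]. The guard matters:
    for [k < #|B|] truncated subtraction would give ['C(_, 0) = 1]. *)
Lemma card_setI_eq (T : finType) (B C : {set T}) (k : nat) : B \subset C ->
  #|[set W : {set T} | (#|W| == k) && (W :&: C == B)]| =
  (if #|B| <= k then 'C(#|T| - #|C|, k - #|B|) else 0)%N.
Proof.
move=> BC; case: leqP => [Bk | kB]; last first.
  apply/eqP; rewrite cards_eq0 -subset0; apply/subsetP=> W.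
  rewrite inE => /andP[/eqP cW /eqP WB].
  by have := subset_leq_card (subsetIl W C); rewrite WB cW leqNgt kB.
have -> : (#|T| - #|C| = #|~: C|)%N by rewrite -(cardsC C) addKn.
rewrite -cards_draws.
have disjBC (X : {set T}) : X \subset ~: C -> X :&: C = set0 /\ X :&: B = set0.
  rewrite -disjoints_subset => XC; split; first exact: disjoint_setI0.
  exact: (disjoint_setI0 (disjointWr BC XC)).
rewrite -[RHS](card_in_imset (f := fun X => X :|: B)) => [|X Y]; last first.
  have XK (Z : {set T}) : Z :&: C = set0 -> (Z :|: B) :\: C = Z.
    move=> /eqP; rewrite setI_eq0 => /setDidPl ZC.
    by rewrite setDUl ZC; move: BC; rewrite -setD_eq0 => /eqP->; rewrite setU0.
  rewrite !inE => /andP[/disjBC[XC _] _] /andP[/disjBC[YC _] _] XY.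
  by rewrite -(XK X) // XY XK.
apply: eq_card => W; rewrite inE; apply/andP/imsetP.
  case=> /eqP cW /eqP WB; exists (W :\: C); last by rewrite -WB setUC setID.
  rewrite inE subsetDr; have := cardsID C W; rewrite WB cW; lia.
case=> X; rewrite inE => /andP[/disjBC[XC XB] /eqP cX] ->.
split; first by rewrite cardsU XB cards0 subn0 cX subnK.
by rewrite setIUl XC set0U (setIidPl BC).
Qed.

(** * Components of the complement for a join of cycles *)

(* The fibres of [cls] are the cycles and [s] is the rotation by one step;
   [s_iter] says that the cycles have length at least 5. *)
Section JoinOfCycles.
Variables (n l m : nat) (adj : rel 'I_n) (s : 'I_n -> 'I_n) (cls : 'I_n -> 'I_l).
Hypothesis s_inj : injective s.
Hypothesis cls_s : forall x, cls (s x) = cls x.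
Hypothesis s_iter : forall x k, (0 < k < 5)%N -> iter k s x != x.
Hypothesis adjE : forall x y, adj x y = [|| cls x != cls y, y == s x | x == s y].
Hypothesis card_cls : forall r, #|[set x | cls x == r]| = m.

Let s1 x : (s x == x) = false. Proof. exact: (negPf (s_iter x (k := 1%N) isT)). Qed.
Let s2 x : (s (s x) == x) = false. Proof. exact: (negPf (s_iter x (k := 2%N) isT)). Qed.
Let s3 x : (s (s (s x)) == x) = false. Proof. exact: (negPf (s_iter x (k := 3%N) isT)). Qed.
Let s4 x : (s (s (s (s x))) == x) = false. Proof. exact: (negPf (s_iter x (k := 4%N) isT)). Qed.

Lemma join_irr : irreflexive adj.
Proof. by move=> x; rewrite adjE eqxx eq_sym s1. Qed.

Lemma join_sym : symmetric adj.
Proof. by move=> x y; rewrite !adjE eq_sym orbCA orbC -orbA. Qed.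

Section Roots.
Variables (W : {set 'I_n}) (r : 'I_l).
Let A := W :&: [set x | cls x == r].
Let C := [set x in coroots adj W | cls x == r].
Let conn := connect (coadj adj W).
Let rt := fingraph.root (coadj adj W).

Let csym : connect_sym (coadj adj W).
Proof. exact/coadj_sym/join_sym. Qed.

(** Vertices of different cycles are adjacent in the join, so the complement never links them. *)
Lemma conn_cls x y : conn x y -> (x \in A) = (y \in A).
Proof.
apply: (closed_connect (a := mem A)) => u v; case/and3P=> uW vW.
by rewrite adjE negb_or negbK !inE uW vW /= => /andP[/eqP->].
Qed.

Lemma rt_in x : (rt x \in A) = (x \in A).
Proof. by rewrite -(conn_cls (connect_root _ _)). Qed.

Lemma in_C x : (x \in C) = (x \in A) && (rt x == x).
Proof. by rewrite !inE andbAC. Qed.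

Lemma conn_nadj x y : x \in A -> y \in A -> y != s x -> x != s y -> conn x y.
Proof.
rewrite !inE => /andP[xW /eqP xr] /andP[yW /eqP yr] ysx xsy; apply: connect1.
by rewrite /coadj /= xW yW adjE xr yr eqxx (negPf ysx) (negPf xsy).
Qed.

Lemma conn_isolated x y : (forall z, z \in A -> z != x -> (z == s x) || (x == s z)) ->
  x \in A -> conn x y -> y = x.
Proof.
move=> iso xA xy; apply/eqP; rewrite -in_set1.
rewrite -(closed_connect (a := mem [set x]) _ xy) ?set11 // => u v uv.
have nadj_x z : coadj adj W x z -> z = x.
  move=> xz; have zA : z \in A by rewrite -(conn_cls (connect1 xz)).
  apply/eqP; apply: contraT => /(iso z zA) adj_xz.
  by move: xz; rewrite /coadj /= adjE adj_xz orbT !andbF.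
rewrite !inE; apply/eqP/eqP => [ux | vx].
  by apply: nadj_x; rewrite -ux.
apply: nadj_x; move: uv; rewrite -vx /coadj /= join_sym.
by rewrite andbCA.
Qed.

(** Consecutive vertices are the only ones in a class not directly linked in the complement; a
    detour exists unless [A] is an edge or a three-vertex path. *)
Lemma conn_succ x : x \in A -> s x \in A ->
  (forall y, A != [set y; s y]) -> (forall y, A != [set y; s y; s (s y)]) ->
  conn x (s x).
Proof.
move=> xA sxA no2 no3.
have in2 y z : (z \in [set y; s y]) = (z == y) || (z == s y) by rewrite !inE.
have in3 y z : (z \in [set y; s y; s (s y)]) = [|| z == y, z == s y | z == s (s y)].
  by rewrite !inE orbA.
(* A vertex [z] outside the four consecutive positions around [x] and [s x] is linked to both. *)
have [/existsP[z /and5P[zA zx zsx zssx szx]] | /existsPn far] :=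
  boolP [exists z, [&& z \in A, z != x, z != s x, z != s (s x) & s z != x]].
  apply: (connect_trans (y := z)); apply: conn_nadj => //; first by rewrite eq_sym.
  by rewrite inj_eq // eq_sym.
have {}far z : z \in A -> [|| z == x, z == s x, z == s (s x) | s z == x].
  by move=> zA; have := far z; rewrite zA !negb_and !negbK.
(* Now [A] lies in four consecutive positions, and missing either end would make it one of the
   excluded sets. *)
have [p pA spx] : exists2 p, p \in A & s p = x.
  have [/existsP[p /andP[pA /eqP]] | /existsPn nop] := boolP [exists p, (p \in A) && (s p == x)].
    by exists p.
  have {}far z : z \in A -> [|| z == x, z == s x | z == s (s x)].
    move=> zA; have := far z zA; have := nop z; rewrite zA /= => /negPf->.
    by rewrite orbF.
  have [ssxA | ssxA] := boolP (s (s x) \in A).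
    case/eqP: (no3 x); apply/setP=> z; rewrite in3.
    apply/idP/or3P=> [/far/or3P //|]; by case=> /eqP->.
  case/eqP: (no2 x); apply/setP=> z; rewrite in2.
  apply/idP/orP=> [zA|]; last by case=> /eqP->.
  by case/or3P: (far z zA) => [->|->|/eqP zE]; [left|right|rewrite zE (negPf ssxA) in zA].
have ssxA : s (s x) \in A.
  apply: contraT => ssxA; case/eqP: (no3 p); apply/setP=> z; rewrite in3 spx.
  apply/idP/or3P=> [zA|]; last by case=> /eqP->.
  case/or4P: (far z zA) => [->|->|/eqP zE|].
  - exact: Or32.
  - exact: Or33.
  - by rewrite zE (negPf ssxA) in zA.
  by rewrite -spx inj_eq // => ->; apply: Or31.
(* The detour runs through [x], [s (s x)], [p], [s x]. The ends [p] and [s (s x)] are nonadjacent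
   because the cycle has length at least 5, which is [s4]. *)
apply: (connect_trans (y := s (s x))).
  by apply: conn_nadj; rewrite // ?s1 // eq_sym s3.
apply: (connect_trans (y := p)); apply: conn_nadj => //.
- by rewrite -(inj_eq s_inj) spx eq_sym s4.
- by rewrite spx s2.
- by rewrite spx s1.
by rewrite -(inj_eq s_inj) spx eq_sym s3.
Qed.

Lemma conn_all x y : x \in A -> y \in A ->
  (forall y, A != [set y; s y]) -> (forall y, A != [set y; s y; s (s y)]) ->
  conn x y.
Proof.
move=> xA yA no2 no3.
have [ysx | ysx] := eqVneq y (s x); first by rewrite ysx in yA *; apply: conn_succ.
have [xsy | xsy] := eqVneq x (s y); last exact: conn_nadj.
by rewrite /conn csym xsy; rewrite xsy in xA; apply: conn_succ.
Qed.

Lemma edge_succ x y : [set y; s y] = [set x; s x] -> y = x.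
Proof.
move=> E; have : y \in [set x; s x] by rewrite -E set21.
rewrite !inE => /orP[/eqP-> // | /eqP yE].
have : s y \in [set x; s x] by rewrite -E set22.
by rewrite yE !inE s2 inj_eq // s1.
Qed.

Lemma path_succ x y : [set y; s y; s (s y)] = [set x; s x; s (s x)] -> y = x.
Proof.
move=> /setP E; have := E y; rewrite !inE eqxx /= => /esym/orP[/orP[/eqP//|/eqP yE]|/eqP yE].
  have := E (s (s y)); rewrite !inE eqxx orbT yE s3 !(inj_eq s_inj) s2 s1.
  by [].
by have := E (s y); rewrite !inE eqxx orbT yE s3 !(inj_eq s_inj) s2 s1.
Qed.

Lemma card_edge x : #|[set x; s x]| = 2%N.
Proof. by rewrite cards2 eq_sym s1. Qed.

Lemma card_path x : #|[set x; s x; s (s x)]| = 3%N.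
Proof. by rewrite -setUA cardsU1 !inE (eq_sym x) s1 (eq_sym x) s2 card_edge. Qed.

(** The last two cardinalities are 0 or 1, as [edge_succ] and [path_succ] show that an edge or path
    has a unique starting vertex. An edge gives two isolated vertices; in a path the middle is
    isolated and the two ends are linked. *)
Lemma card_coroots_cls :
  #|C| = ((A != set0) + #|[set x | (cls x == r) && (A == [set x; s x])]|
           + #|[set x | (cls x == r) && (A == [set x; s x; s (s x)])]|)%N.
Proof.
set E2 := [set x | _]; set E3 := [set x | _].
have clsA x : x \in A -> cls x == r by rewrite !inE => /andP[].
have [A0 | [a aA]] := set_0Vmem A.
  have -> : C = set0 by apply/setP=> x; rewrite in_C A0 !inE.
  have -> : E2 = set0.
    apply/setP=> x; rewrite !inE A0 andbC; case: eqP => // /setP/(_ x).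
    by rewrite !inE eqxx.
  have -> : E3 = set0.
    apply/setP=> x; rewrite !inE A0 andbC; case: eqP => // /setP/(_ x).
    by rewrite !inE eqxx.
  by rewrite A0 eqxx !cards0.
have -> : A != set0 by apply/set0Pn; exists a.
have [/existsP[x /eqP Ax] | /existsPn no2] := boolP [exists x, A == [set x; s x]].
  have xA : x \in A by rewrite Ax set21.
  have sxA : s x \in A by rewrite Ax set22.
  have -> : C = A.
    apply/setP=> v; rewrite in_C; case: (boolP (v \in A)) => //= vA.
    apply/eqP; apply: (conn_isolated _ vA (connect_root (coadj adj W) v)) => z zA zv.
    move: vA zA zv; rewrite Ax !inE => /orP[]/eqP-> /orP[]/eqP->; rewrite ?eqxx ?orbT //.
  have -> : E2 = [set x].
    apply/setP=> y; rewrite !inE Ax; apply/andP/eqP=> [[_ /eqP]|->].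
      by move=> /esym/edge_succ.
    by rewrite clsA.
  have -> : E3 = set0.
    apply/setP=> y; rewrite !inE Ax andbC; case: eqP => // H.
    by have := card_path y; rewrite -H card_edge.
  by rewrite Ax card_edge cards1 cards0.
have E20 : E2 = set0 by apply/setP=> y; rewrite !inE (negPf (no2 y)) andbF.
have [/existsP[x /eqP Ax] | /existsPn no3] := boolP [exists x, A == [set x; s x; s (s x)]].
  have xA : x \in A by rewrite Ax !inE eqxx.
  have sxA : s x \in A by rewrite Ax !inE eqxx orbT.
  have ssxA : s (s x) \in A by rewrite Ax !inE eqxx orbT.
  have iso y : conn (s x) y -> y = s x.
    apply: conn_isolated => // z; rewrite Ax !inE => /orP[/orP[]|] /eqP->; rewrite ?eqxx ?orbT //.
  have rssx : rt (s (s x)) = rt x.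
    apply/(fingraph.rootP csym); apply: conn_nadj => //; first by rewrite eq_sym s3.
    by rewrite s1.
  have rsx : rt (s x) = s x by apply/iso/connect_root.
  have rxsx : rt x != s x.
    apply/eqP=> rx; have : x = s x.
      by apply: iso; rewrite /conn csym -rx; apply: connect_root.
    by move/eqP; rewrite eq_sym s1.
  have -> : C = [set rt x; s x].
    apply/setP=> v; rewrite in_C in_set2; apply/andP/orP.
      rewrite Ax !inE => -[/orP[/orP[]|] /eqP->]; first by rewrite eq_sym; left.
        by right.
      by rewrite rssx eq_sym; left.
    case=> /eqP->; last by rewrite sxA rsx.
    by rewrite rt_in xA /rt root_root.
  have -> : E3 = [set x].
    apply/setP=> y; rewrite !inE Ax; apply/andP/eqP=> [[_ /eqP]|->].
      by move=> /esym/path_succ.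
    by rewrite clsA.
  by rewrite E20 cards0 cards1 cards2 rxsx.
have E30 : E3 = set0 by apply/setP=> y; rewrite !inE (negPf (no3 y)) andbF.
rewrite E20 E30 !cards0 !addn0; have -> : C = [set rt a].
  apply/setP=> v; rewrite in_C in_set1; apply/andP/eqP=> [[vA /eqP <-]|->].
    by apply/(fingraph.rootP csym)/conn_all.
  by rewrite rt_in aA /rt root_root.
by rewrite cards1.
Qed.

End Roots.

(** Sum [card_coroots_cls] over classes and sets. Sets missing a given class number ['C(n - m, k)],
    and that term is moved to the left to avoid subtraction. *)
Lemma sum_coroots (k : nat) :
  (\sum_(W : {set 'I_n} | #|W| == k) #|coroots adj W| + l * 'C(n - m, k) =
   l * 'C(n, k) + n * (if 2 <= k then 'C(n - m, k - 2) else 0)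
     + n * (if 3 <= k then 'C(n - m, k - 3) else 0))%N.
Proof.
pose Cl r := [set x | cls x == r].
have -> : (\sum_(W : {set 'I_n} | #|W| == k) #|coroots adj W| =
  \sum_(W : {set 'I_n} | #|W| == k) \sum_(r < l) ((W :&: Cl r != set0) +
     #|[set x | (cls x == r) && (W :&: Cl r == [set x; s x])]|
           + #|[set x | (cls x == r) && (W :&: Cl r == [set x; s x; s (s x)])]|))%N.
  apply: eq_bigr => W _; rewrite -sum1_card (partition_big cls predT) //=.
  apply: eq_bigr => r _; rewrite -card_coroots_cls -sum1_card.
  by apply: eq_bigl => x; rewrite !inE.
(* Double counting: for each [x], count the sets whose trace on the class of [x] is [F x]. *)
have fiber (F : 'I_n -> {set 'I_n}) (b : nat) : (forall x, F x \subset Cl (cls x)) ->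
   (forall x, #|F x| = b) ->
   (\sum_(W : {set 'I_n} | #|W| == k) \sum_(r < l)
      #|[set x | (cls x == r) && (W :&: Cl r == F x)]| =
    n * (if b <= k then 'C(n - m, k - b) else 0))%N.
  move=> FCl cF.
  transitivity (\sum_(W : {set 'I_n} | #|W| == k) \sum_x (W :&: Cl (cls x) == F x : nat))%N.
    apply: eq_bigr => W _; rewrite [RHS](partition_big cls predT) //=.
    apply: eq_bigr => r _; rewrite -sum1_card big_mkcond [RHS]big_mkcond /=.
    by apply: eq_bigr => x _; rewrite inE; case: eqP => //= ->; case: eqP.
  rewrite exchange_big /= -[n in (n * _)%N]card_ord -sum_nat_const.
  apply: eq_bigr => x _.
  rewrite -(cF x) -[n in (n - m)%N]card_ord -(card_cls (cls x)) -card_setI_eq //.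
  rewrite -sum1_card big_mkcond [RHS]big_mkcond /=; apply: eq_bigr => W _.
  by rewrite inE; case: eqP => //= _; case: eqP.
under eq_bigr do rewrite !big_split /=.
rewrite !big_split /=.
rewrite (fiber (fun x => [set x; s x]) 2%N) //; last first.
- exact: card_edge.
- by move=> x; apply/subsetP=> y; rewrite !inE => /orP[]/eqP->; rewrite ?cls_s.
rewrite (fiber (fun x => [set x; s x; s (s x)]) 3%N) //; last first.
- exact: card_path.
- by move=> x; apply/subsetP=> y; rewrite !inE => /orP[/orP[]|]/eqP->; rewrite ?cls_s.
set e2 := (n * _)%N; set e3 := (n * _)%N.
suff <- : (\sum_(W : {set 'I_n} | #|W| == k) \sum_(r < l) (W :&: Cl r != set0)
   + l * 'C(n - m, k) = l * 'C(n, k))%N by rewrite addnAC (addnAC _ e2).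
have lE c : (l * c = \sum_(r < l) c)%N by rewrite sum_nat_const card_ord.
rewrite exchange_big /= !lE -big_split /=.
apply: eq_bigr => r _.
have -> : 'C(n - m, k) = #|[set W : {set 'I_n} | (#|W| == k) && (W :&: Cl r == set0)]|.
  by rewrite card_setI_eq ?sub0set // cards0 subn0 card_cls card_ord.
rewrite -[n in 'C(n, k)]card_ord -card_draws.
rewrite -[RHS](cardsID [set W : {set 'I_n} | W :&: Cl r == set0]) addnC.
congr (_ + _)%N; first by apply: eq_card => W; rewrite !inE.
rewrite -sum1_card big_mkcond [RHS]big_mkcond /=.
by apply: eq_bigr => W _; rewrite !inE; case: eqP => // _; case: eqP.
Qed.

(** Pascal's rule merges the edge and path contributions into a single binomial coefficient. *)
Lemma betti_join_cycles (K : fieldType) (i : nat) : (0 < i)%N ->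
  (betti K adj i i.+1 + 'C(n, i.+1) + l * 'C(n - m, i.+1) =
   l * 'C(n, i.+1) + n * 'C((n - m).+1, i - 1))%N.
Proof.
move=> i0; rewrite (betti_linear_strand K join_irr join_sym i0).
have := sum_coroots i.+1.
have -> : (\sum_(W : {set 'I_n} | #|W| == i.+1) #|coroots adj W| =
  \sum_(W : {set 'I_n} | #|W| == i.+1) (#|coroots adj W| - 1) + 'C(n, i.+1))%N.
  rewrite -[n in 'C(n, _)]card_ord -card_draws -sum1_card.
  rewrite [X in (_ + X)%N](eq_bigl (fun W : {set 'I_n} => #|W| == i.+1)) => [|W];
    last by rewrite inE.
  rewrite -big_split /=; apply: eq_bigr => W /eqP cW.
  (* A nonempty [W] has a root, so the truncated subtraction of 1 is exact. *)
  rewrite subnK // card_gt0; have /card_gt0P[v vW] : (0 < #|W|)%N by rewrite cW.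
  apply/set0Pn; exists (fingraph.root (coadj adj W) v).
  by rewrite inE coroot_in vW (root_root (coadj_sym join_sym W)) eqxx.
move=> ->; rewrite -addnA -mulnDr; congr (_ + _ * _)%N.
case: i i0 => // -[|i] _ /=; first by rewrite !bin0.
by rewrite !subSS !subn0 binS addnC.
Qed.

End JoinOfCycles.

(** * The circulant graph as a join of cycles *)

Lemma cyclic_dist_eq a b l N : (a < b -> b < N -> 0 < l -> 5 * l <= N ->
  (minn (b - a) (N - (b - a)) == l) =
  (b == if a + l < N then a + l else a + l - N) || (a == if b + l < N then b + l else b + l - N))%N.
Proof.
move=> ab bN l0 lN.
(* Since [2 * l <= N], the minimum is [l] as soon as one of the two arcs has length [l]. *)
have -> : (minn (b - a) (N - (b - a)) == l)%N =
    ((b - a == l) || (N - (b - a) == l))%N.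
  by apply/eqP/orP => [|[]/eqP]; lia.
congr (_ || _).
  by case: ltnP => wrap; apply/eqP/eqP; lia.
by case: ltnP => wrap; apply/eqP/eqP; lia.
Qed.

Section CirculantJoin.
Variables (l m : nat).
Hypotheses (l_gt0 : (0 < l)%N) (m_ge5 : (5 <= m)%N).
Local Notation n := (l * m)%N.

Let n_gt0 : (0 < n)%N. Proof. by rewrite muln_gt0 l_gt0 (leq_trans _ m_ge5). Qed.
Let n_ge5l : (5 * l <= n)%N. Proof. by rewrite mulnC leq_pmul2l. Qed.

(** The cycles are the residue classes modulo [l]; as [l] divides [n], adding [l] modulo [n] rotates
    each of them. *)
Definition shift (x : 'I_n) : 'I_n := Ordinal (ltn_pmod (x + l) n_gt0).
Definition residue (x : 'I_n) : 'I_l := Ordinal (ltn_pmod x l_gt0).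

Lemma shift_inj : injective shift.
Proof.
move=> x y /(congr1 val)/eqP /=; rewrite eqn_modDr !modn_small // => /eqP.
exact: val_inj.
Qed.

Lemma residue_shift x : residue (shift x) = residue x.
Proof. by apply: val_inj; rewrite /= modn_dvdm ?dvdn_mulr // modnDr. Qed.

Lemma iter_shift x k : iter k shift x = ((x + k * l) %% n)%N :> nat.
Proof.
elim: k => [|k IHk]; first by rewrite addn0 modn_small.
by rewrite /= IHk modnDml mulSn addnAC addnA.
Qed.

Lemma iter_shift_neq x k : (0 < k < 5)%N -> iter k shift x != x.
Proof.
move=> /andP[k0 k5]; rewrite -(inj_eq val_inj) /= iter_shift.
rewrite -[X in _ != X](modn_small (ltn_ord x)) -{2}[val x]addn0 eqn_modDl mod0n.
rewrite modn_small ?muln_eq0 -?lt0n; first by move: k0 l_gt0; lia.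
by apply: leq_trans n_ge5l; rewrite ltn_pmul2r.
Qed.

Lemma card_residue r : #|[set x | residue x == r]| = m.
Proof.
have lt_n (q : 'I_m) : (r + q * l < n)%N.
  have : (q.+1 * l <= m * l)%N by rewrite leq_mul2r ltn_ord orbT.
  by rewrite mulSn [(m * l)%N]mulnC; have := ltn_ord r; lia.
rewrite -[RHS]card_ord -(card_imset (f := fun q => Ordinal (lt_n q))) => [|p q].
  apply: eq_card => x; rewrite inE -(inj_eq val_inj) /=; apply/eqP/imsetP => [xr | [q _ ->]].
    have x_m : (x %/ l < m)%N by rewrite ltn_divLR // [(m * l)%N]mulnC.
    by exists (Ordinal x_m) => //; apply: val_inj; rewrite /= -xr addnC -divn_eq.
  by rewrite /= addnC modnMDl modn_small.
move=> /(congr1 val) /= /eqP; rewrite eqn_add2l eqn_pmul2r // => /eqP.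
exact: val_inj.
Qed.

Lemma modn_add_lt (x : 'I_n) : ((x + l) %% n = if x + l < n then x + l else x + l - n)%N.
Proof.
case: ltnP => xl; first by rewrite modn_small.
rewrite -{1}(subnK xl) modnDr modn_small //.
by have := ltn_ord x; move: n_ge5l; lia.
Qed.

Lemma circ_adj_sym (N : nat) (S : pred nat) : symmetric (@circ_adj N S).
Proof. by move=> x y; rewrite /circ_adj eq_sym; case: ltngtP => // ->. Qed.

Lemma circ_adj_join x y :
  circ_adj (join_cycles_S l m) x y =
  [|| residue x != residue y, y == shift x | x == shift y].
Proof.
have half_n : ((n./2).*2 <= n < (n./2).*2.+2)%N by have := odd_double_half n; case: odd; lia.
wlog xy : x y / (x <= y)%N => [adj_le|].
  case: (leqP x y) => [/adj_le // | /ltnW yx].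
  by rewrite circ_adj_sym (adj_le _ _ yx) [residue y == _]eq_sym [X in _ || X]orbC.
have -> : circ_adj (join_cycles_S l m) x y =
    (x != y) && join_cycles_S l m (minn (y - x) (n - (y - x))) by rewrite /circ_adj xy.
have ordE N (a b : 'I_N) : (a == b) = ((a : nat) == (b : nat)) by [].
rewrite !ordE /= !modn_add_lt.
case: (eqVneq (x : nat) y) => [-> | x_y] /=.
  rewrite eqxx orbb; move: l_gt0 n_ge5l (ltn_ord y).
  by case: (ltnP (y + l)); lia.
(* Since [l] divides [n], replacing [y - x] by [n - (y - x)] does not change divisibility by [l]. *)
have dvd_d : (l %| minn (y - x) (n - (y - x)))%N = (x %% l == y %% l)%N.
  rewrite [RHS]eq_sym eqn_mod_dvd //; case: leqP => // _.
  by rewrite dvdn_subr ?dvdn_mulr //; have := ltn_ord y; lia.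
have {x_y xy} xy : (x < y)%N by rewrite ltn_neqAle x_y.
rewrite /join_cycles_S /= dvd_d.
have -> : (0 < minn (y - x) (n - (y - x)))%N by rewrite leq_min; have := ltn_ord y; lia.
have -> : (minn (y - x) (n - (y - x)) <= n./2)%N.
  by move: n (y - x)%N half_n => N d; rewrite geq_min; lia.
case: (_ %% _ == _)%N; rewrite /= ?orbT // orbF.
exact: cyclic_dist_eq.
Qed.

End CirculantJoin.

Theorem theorem4p3 (K : fieldType) (m l i : nat) :
  (5 <= m)%N -> (2 <= l)%N -> (1 <= i)%N ->
  (Posz (@betti K (l * m)%N (@circ_adj (l * m)%N (join_cycles_S l m)) i i.+1)
   = Posz (l * m * 'C((l - 1) * m + 1, i - 1))%N
     + Posz ((l - 1) * 'C(l * m, i.+1))%N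
     - Posz (l * 'C((l - 1) * m, i.+1))%N)%R.
Proof.
move=> m_ge5 l_ge2 i_gt0; have l_gt0 := ltnW l_ge2.
have := betti_join_cycles (@shift_inj l m l_gt0 m_ge5)
  (@residue_shift l m l_gt0 m_ge5) (@iter_shift_neq l m l_gt0 m_ge5)
  (@circ_adj_join l m l_gt0 m_ge5) (@card_residue l m l_gt0 m_ge5) K i_gt0.
have -> : (l * m - m = (l - 1) * m)%N by rewrite mulnBl mul1n.
rewrite addn1 [((l - 1) * 'C(_, _))%N]mulnBl mul1n.
(* This bound makes the truncated subtraction coming from [l - 1] exact. *)
have := leq_pmull 'C(l * m, i.+1) l_gt0; lia.
Qed.
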